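(* Let $\alpha=(a_1,\ldots,a_k)$ be a composition of a non-negative integer $n$. Then \[(\zeta^{-1})_-(F_\alpha)=\frac{(-1)^{n+p_-(\tilde\alpha)}}{2^{2\lfloor n/2\rfloor}}\,C\bigl(p_-(\tilde\alpha),\lfloor n/2\rfloor-p_-(\tilde\alpha)\bigr),\] \[(\zeta^{-1})_+(F_\alpha)=\begin{cases}\dfrac{(-1)^{p_+(\alpha')}}{2^n}\,C\bigl(p_+(\alpha'),n/2-p_+(\alpha')\bigr)&\text{if } n\text{ is even},\\0&\text{if } n\text{ is odd.}\end{cases}\]
   Context: $\Bbbk$ is a field of characteristic $\neq2$. A composition $\alpha=(a_1,\ldots,a_k)$ of $n$ is a sequence of positive integers with sum $n$; its descent set is $D(\alpha)=\{a_1,a_1+a_2,\ldots,a_1+\cdots+a_{k-1}\}\subseteq\{1,\ldots,n-1\}$, which determines $\alpha$. $\tilde\alpha=(a_k,\ldots,a_1)$ is the reversal, and the conjugate $\alpha'$ is the composition of $n$ with $D(\alpha')=\{1,\ldots,n-1\}\setminus\{n-d: d\in D(\alpha)\}$ (its ribbon diagram is the reflection of that of $\alpha$ in the line $y=x$). Statistics: $p_-(\alpha)=\#\{i\ne k: a_i>1\}$; $p_+(\alpha)=1+\#\{i\ne1,k: a_i>1\}$ if $k>1$, $p_+(\alpha)=0$ if $k\le1$. ${\mathcal{Q}Sym}$ is the graded connected Hopf algebra of quasi-symmetric functions over $\Bbbk$, with monomial basis $M_\alpha=\sum_{i_1<\cdots<i_k}x_{i_1}^{a_1}\cdots x_{i_k}^{a_k}$,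 fundamental basis $F_\alpha=\sum_{\beta\ge\alpha}M_\beta$ ($\beta\ge\alpha$: $\beta$ refines $\alpha$), ordinary product, coproduct $\Delta(M_\alpha)=\sum_{i=0}^kM_{(a_1,\ldots,a_i)}\otimes M_{(a_{i+1},\ldots,a_k)}$. Convolution $\rho\psi=m\circ(\rho\otimes\psi)\circ\Delta$; characters (algebra morphisms to $\Bbbk$) form a group under convolution. For a functional $\varphi$, $\bar\varphi(h)=(-1)^n\varphi(h)$ on homogeneous $h$ of degree $n$; $\varphi$ is even if $\bar\varphi=\varphi$ and odd if $\bar\varphi=\varphi^{-1}$. Every character factors uniquely as $\varphi=\varphi_+\varphi_-$ with $\varphi_+$ even and $\varphi_-$ odd characters. $\zeta(f)=f(1,0,0,\ldots)$ is the universal character ($\zeta(F_\alpha)=1$ if $\alpha=()$ or $\alpha=(n)$, else $0$), $\zeta^{-1}$ its convolution inverse, and $(\zeta^{-1})_\pm$ the even and odd parts of $\zeta^{-1}$. $C(p,q)=\frac{(2p)!(2q)!}{p!(p+q)!q!}$. *)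

(* Defs.v *)
From HB Require Import structures.
From mathcomp Require Import all_boot all_order all_algebra.
Set Implicit Arguments. Unset Strict Implicit. Unset Printing Implicit Defensive.
Import Order.TTheory GRing.Theory Num.Theory.
Local Open Scope ring_scope.

Definition is_comp (a : seq nat) : bool := all (fun x => 0 < x)%N a.

(* Linear functionals on QSym are represented by their values on the
   monomial basis: phi a = phi(M_a) (only compositions a matter). *)

(* quasi-shuffle: M_a * M_b = \sum_(g <- qsh a b) M_g *)
Fixpoint qsh (a b : seq nat) {struct a} : seq (seq nat) :=
  match a with
  | [::] => [:: b]
  | x :: a' =>
    let fix qsh_in (b : seq nat) : seq (seq nat) :=
      match b with
      | [::] => [:: a]
      | y :: b' =>
          map (cons x) (qsh a' b) ++ map (cons y) (qsh_in b')
            ++ map (cons (x + y)%N) (qsh a' b')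
      end in qsh_in b
  end.

Section Funct.
Variable K : fieldType.

(* convolution, using Delta(M_a) = \sum_i M_(a_1..a_i) (x) M_(a_(i+1)..a_k) *)
Definition conv (r s : seq nat -> K) (a : seq nat) : K :=
  \sum_(i < (size a).+1) r (take i a) * s (drop i a).

Definition eps (a : seq nat) : K := if a == [::] then 1 else 0.

(* universal character zeta(f) = f(1,0,0,...): zeta(M_a) = 1 iff size a <= 1 *)
Definition zeta (a : seq nat) : K := if (size a <= 1)%N then 1 else 0.

Definition bar (phi : seq nat -> K) (a : seq nat) : K := (-1) ^+ (sumn a) * phi a.

Definition is_character (phi : seq nat -> K) : Prop :=
  phi [::] = 1 /\
  forall a b, is_comp a -> is_comp b ->
    phi a * phi b = \sum_(g <- qsh a b) phi g.

Definition is_conv_inverse (psi phi : seq nat -> K) : Prop :=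
  forall a, is_comp a -> conv psi phi a = eps a /\ conv phi psi a = eps a.

Definition is_even (phi : seq nat -> K) : Prop :=
  forall a, is_comp a -> bar phi a = phi a.

Definition is_odd (phi : seq nat -> K) : Prop := is_conv_inverse (bar phi) phi.
End Funct.

Fixpoint compsAux (fuel n : nat) : seq (seq nat) :=
  match fuel with
  | 0 => if n == 0%N then [:: [::]] else [::]
  | fuel'.+1 => if n == 0%N then [:: [::]] else
      flatten [seq [seq i :: c | c <- compsAux fuel' (n - i)] | i <- iota 1 n]
  end.
Definition comps (n : nat) : seq (seq nat) := compsAux n n.

Definition refinements (a : seq nat) : seq (seq nat) :=
  foldr (fun x acc => flatten [seq [seq c ++ d | d <- acc] | c <- comps x])
        [:: [::]] a.

(* phi(F_a) = \sum_(beta >= a) phi(M_beta) *)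
Definition valF (K : fieldType) (phi : seq nat -> K) (a : seq nat) : K :=
  \sum_(b <- refinements a) phi b.

Definition descents (a : seq nat) : seq nat :=
  take (size a).-1 (scanl addn 0%N a).

(* composition of n > 0 with descent set given by sorted S within [1,n-1] *)
Definition comp_of_desc (n : nat) (S : seq nat) : seq nat :=
  pairmap (fun x y => y - x)%N 0%N (S ++ [:: n]).

Definition conjc (a : seq nat) : seq nat :=
  let n := sumn a in
  if n == 0%N then [::] else
  comp_of_desc n [seq i <- iota 1 n.-1 | (n - i)%N \notin descents a].

Definition pminus (a : seq nat) : nat :=
  count (fun x => 1 < x)%N (take (size a).-1 a).

Definition pplus (a : seq nat) : nat :=
  if (1 < size a)%N then (1 + count (fun x => 1 < x)%N (behead (take (size a).-1 a)))%N
  else 0%N.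

(* C(p,q) = (2p)!(2q)!/(p!(p+q)!q!)  (an integer) *)
Definition Cpq (p q : nat) : nat :=
  ((p.*2)`! * (q.*2)`!) %/ (p`! * (p + q)`! * q`!).

(* Main.v *)
(* In the convolution algebra write zeta = A + B with A the even and B the odd
   part, and T = B A^-1.  The square of the odd part of zeta^-1 is
   bar(zeta) zeta^-1 = (1 - T) / (1 + T), so the odd and even parts are
   (1 - T) (1 - T^2)^(-1/2) and A^-1 (1 - T^2)^(-1/2).  As T^j is supported on
   compositions with exactly j odd entries, the first of them odd, the values on
   M_alpha depend only on the length and the number of odd entries of alpha, and
   on the parity of its first entry.  Summing over the refinements of a
   composition factors over its entries: an entry a > 1 contributes
   (-1)^a t^(a-2) (t^2 - 1), with t marking odd entries, so that the sum is an
   iterated difference phi(j+2) - phi(j) of the coefficients of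
   (1 - T^2)^(-1/2).  Those iterated differences are the numbers C(p, q), by the
   recurrence C(p+1, q) + C(p, q+1) = 4 C(p, q). *)
Require Import Defs.
From HB Require Import structures.
From mathcomp Require Import all_boot all_order all_algebra.
From mathcomp Require Import zify ring.
Set Implicit Arguments. Unset Strict Implicit. Unset Printing Implicit Defensive.
Import GRing.Theory.
Local Open Scope ring_scope.

(** * Entries of compositions: positivity and parity *)

Lemma is_comp_take i a : is_comp a -> is_comp (take i a).
Proof. by move=> /allP h; apply/allP => x /mem_take /h. Qed.

Lemma is_comp_drop i a : is_comp a -> is_comp (drop i a).
Proof. by move=> /allP h; apply/allP => x /mem_drop /h. Qed.

Lemma odd_sumn a : odd (sumn a) = odd (count odd a).
Proof. by elim: a => //= x a IH; rewrite !oddD IH oddb. Qed.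

Lemma count_gt1_double a : is_comp a -> ((count (ltn 1) a).*2 <= sumn a)%N.
Proof. by elim: a => //= x a IH /andP[x0 /IH h]; case: ltnP => ? /=; lia. Qed.

(** * Convolution of functionals *)

Section Convolution.
Variable K : fieldType.
Implicit Types r s t : seq nat -> K.

Lemma conv_nil r s : conv r s [::] = r [::] * s [::].
Proof. by rewrite /conv big_ord_recl big_ord0 addr0. Qed.

Lemma conv_cons r s x a :
  conv r s (x :: a) = r [::] * s (x :: a) + conv (fun b => r (x :: b)) s a.
Proof. by rewrite /conv /= big_ord_recl. Qed.

Lemma conv_ends r s x a :
  conv r s (x :: a) = r [::] * s (x :: a) + r (x :: a) * s [::]
    + \sum_(i < size a) r (x :: take i a) * s (drop i a).
Proof.
rewrite conv_cons /conv big_ord_recr /= take_size drop_size.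
by rewrite addrA addrAC.
Qed.

Lemma eq_conv r r' s s' a :
    (forall b, is_comp b -> r b = r' b) -> (forall b, is_comp b -> s b = s' b) ->
  is_comp a -> conv r s a = conv r' s' a.
Proof.
move=> hr hs ca; apply: eq_bigr => i _.
by rewrite hr ?hs ?is_comp_take ?is_comp_drop.
Qed.

Lemma convDl r r' s a :
  conv (fun b => r b + r' b) s a = conv r s a + conv r' s a.
Proof. by rewrite /conv -big_split; apply: eq_bigr => i _; rewrite mulrDl. Qed.

Lemma convZl c r s a : conv (fun b => c * r b) s a = c * conv r s a.
Proof. by rewrite /conv big_distrr; apply: eq_bigr => i _; rewrite /= mulrA. Qed.

Lemma conv_assoc r s t a : conv (conv r s) t a = conv r (conv s t) a.
Proof.
elim: a r => [|x a IH] r; first by rewrite !conv_nil mulrA.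
rewrite !conv_cons conv_nil.
rewrite [X in _ + X = _](_ : _ = conv (fun b => r [::] * s (x :: b)
  + conv (fun b' => r (x :: b')) s b) t a); last first.
  by apply: eq_bigr => i _; rewrite conv_cons.
by rewrite convDl convZl IH mulrDr !mulrA addrA.
Qed.

Lemma conv_eps_l r a : conv (eps K) r a = r a.
Proof.
case: a => [|x a]; first by rewrite conv_nil mul1r.
by rewrite conv_cons mul1r [X in _ + X]big1 ?addr0 // => i _; rewrite mul0r.
Qed.

Lemma conv_eps_r r a : conv r (eps K) a = r a.
Proof.
elim: a r => [|x a IH] r; first by rewrite conv_nil mulr1.
by rewrite conv_cons mulr0 add0r IH.
Qed.

(** [zeta] vanishes in length two or more, so only the cuts before and just after [x] contribute. *)
Lemma conv_zeta_cons r x a : conv (zeta K) r (x :: a) = r (x :: a) + r a.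
Proof.
rewrite conv_cons mul1r; congr (_ + _).
case: a => [|y a]; first by rewrite conv_nil mul1r.
by rewrite conv_cons mul1r [X in _ + X]big1 ?addr0 // => i _; rewrite mul0r.
Qed.

(** Convolving zeta zp zm = 1 on the right with [bar zm], the inverse of [zm], gives a relation
    linear in the two parts. *)
Lemma conv_zeta_even_part (zp zm : seq nat -> K) :
    is_odd zm -> is_conv_inverse (conv zp zm) (zeta K) ->
  forall a, is_comp a -> conv (zeta K) zp a = bar zm a.
Proof.
move=> zm_odd hinv a ca.
rewrite -[LHS]conv_eps_r -[RHS]conv_eps_l.
rewrite (eq_conv (r' := conv (zeta K) zp) (s' := conv zm (bar zm))) //; last first.
  by move=> b /zm_odd[].
rewrite -conv_assoc; apply: eq_conv => // b cb.
by rewrite conv_assoc; case: (hinv b cb).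
Qed.

Lemma even_odd_sum0 (phi : seq nat -> K) :
    (2%:R : K) != 0 -> is_even phi ->
  forall a, is_comp a -> odd (sumn a) -> phi a = 0.
Proof.
move=> char2 ev a ca od; have := ev a ca.
rewrite /bar -signr_odd od expr1 mulN1r => /eqP; rewrite eq_sym -addr_eq0.
by rewrite -mulr2n -mulr_natl mulf_eq0 (negbTE char2) /= => /eqP.
Qed.

(* A cut whose right-hand part is empty or starts with an odd entry is
   determined by the number of odd entries to its left. *)
Lemma sum_cuts_odd (F : nat -> K) a :
  \sum_(i < (size a).+1) (if odd (head 1%N (drop i a))
      then F (count odd (take i a)) else 0) = \sum_(s < (count odd a).+1) F s.
Proof.
elim: a F => [|x a IH] F; first by rewrite !big_ord_recl !big_ord0.
rewrite big_ord_recl /=; case: (boolP (odd x)) => ox /=.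
  by rewrite (IH (fun j => F (1 + j)%N)) add1n [in RHS]big_ord_recl.
by rewrite add0r -(IH F).
Qed.

End Convolution.

(** * The integers C(p, q) and central binomial coefficients *)

Section CentralBinomials.
Local Open Scope nat_scope.

Lemma fact_doubleS p : (p.+1.*2)`! = (p.*2).+2 * (p.*2).+1 * (p.*2)`!.
Proof. by rewrite doubleS !factS mulnA. Qed.

(** [z] and [z1] stand for C(p, q) and C(p, q+1) through their defining products, so the ratio is
    available before integrality is known. *)
Lemma Cpq_dvd_rec p q z z1 :
    z * (p`! * (p + q)`! * q`!) = (p.*2)`! * (q.*2)`! ->
    z1 * (p`! * (p + q.+1)`! * q.+1`!) = (p.*2)`! * (q.+1.*2)`! ->
  z1 * (p + q).+1 = (4 * q + 2) * z.
Proof.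
move=> hz; rewrite fact_doubleS addnS !factS => hz1.
have M0 : 0 < q.+1 * (p`! * (p + q)`! * q`!) by rewrite !muln_gt0 !fact_gt0.
apply/eqP; rewrite -(eqn_pmul2r M0); apply/eqP.
transitivity ((q.*2).+2 * (q.*2).+1 * ((p.*2)`! * (q.*2)`!)); last by rewrite -hz; nia.
by rewrite [RHS]mulnCA -hz1; nia.
Qed.

Lemma Cpq_dvd p q : p`! * (p + q)`! * q`! %| (p.*2)`! * (q.*2)`!.
Proof.
elim: p q => [|p IH] q.
  rewrite add0n fact0 mul1n !mul1n -(bin_fact (n := q.*2) (m := q)) -?addnn ?leq_addr //.
  by rewrite addnK dvdn_mull.
have /dvdnP[z /esym hz] := IH q; have /dvdnP[z1 /esym hz1] := IH q.+1.
have e := Cpq_dvd_rec hz hz1.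
(* The witness is 4 C(p, q) - C(p, q+1); by [e], z1 <= 4 z, so the subtraction does not truncate. *)
apply/dvdnP; exists (4 * z - z1).
have e2 : (4 * z - z1) * (p + q).+1 = (4 * p + 2) * z by nia.
rewrite addSn fact_doubleS !factS -mulnA -hz.
transitivity (p.+1 * ((4 * z - z1) * (p + q).+1) * (p`! * (p + q)`! * q`!)).
  by rewrite e2; nia.
by move: (4 * z - z1) => w; nia.
Qed.

Lemma Cpq_mul p q : Cpq p q * (p`! * (p + q)`! * q`!) = (p.*2)`! * (q.*2)`!.
Proof. by rewrite divnK ?Cpq_dvd. Qed.

Lemma Cpq_succr p q : Cpq p q.+1 * (p + q).+1 = (4 * q + 2) * Cpq p q.
Proof. exact: Cpq_dvd_rec (Cpq_mul _ _) (Cpq_mul _ _). Qed.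

Lemma Cpq_sym p q : Cpq p q = Cpq q p.
Proof.
rewrite /Cpq addnC; congr (_ %/ _); first exact: mulnC.
by rewrite mulnC (mulnC p`!) mulnA.
Qed.

(** Add the ratios for raising p and q: (4p + 2) + (4q + 2) = 4 (p + q + 1). *)
Lemma Cpq_rec p q : Cpq p.+1 q + Cpq p q.+1 = 4 * Cpq p q.
Proof.
have := Cpq_succr p q; have := Cpq_succr q p.
rewrite (Cpq_sym q p.+1) (Cpq_sym q p) (addnC q p) => h1 h2.
apply/eqP; rewrite -(eqn_pmul2r (ltn0Sn (p + q))); apply/eqP; nia.
Qed.

(* The reflection i -> m - i turns the weight i into its average m / 2. *)
Lemma double_sum_weighted_square (u : nat -> nat) m :
  2 * (\sum_(i < m.+1) i * (u i * u (m - i))) = m * \sum_(i < m.+1) u i * u (m - i).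
Proof.
rewrite mul2n -addnn {1}(reindex_inj rev_ord_inj) -big_split big_distrr /=.
apply: eq_bigr => i _; have le_im : i <= m by rewrite -ltnS.
by rewrite subSS subKn // (mulnC (u (m - i))) -mulnDl subnK.
Qed.

(** The series (1 - 4x)^(-1/2) has square 1 / (1 - 4x). Averaging the weight turns the ratio
    recurrence into (m+1) S(m+1) = 4 (m+1) S(m) for these sums. *)
Lemma Cpq0_conv m : \sum_(i < m.+1) Cpq 0 i * Cpq 0 (m - i) = 4 ^ m.
Proof.
have rec i : Cpq 0 i.+1 * i.+1 = (4 * i + 2) * Cpq 0 i by rewrite -Cpq_succr.
have u0 : Cpq 0 0 = 1 by [].
elim: m => [|m IH]; first by rewrite big_ord_recl big_ord0.
move: (Cpq 0) u0 rec IH => u u0 rec IH.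
apply/eqP; rewrite -(eqn_pmul2l (ltn0Sn m)) -double_sum_weighted_square expnS -IH.
apply/eqP; rewrite big_ord_recl mul0n add0n.
have := double_sum_weighted_square u m.
rewrite [X in _ -> 2 * X = _](_ : _ = \sum_(i < m.+1)
  (4 * (i * (u i * u (m - i))) + 2 * (u i * u (m - i)))); last first.
  apply: eq_bigr => i _.
  rewrite lift0 subSS mulnA (mulnC i.+1) rec.
  by move: (u i) (u (m - i)) => v w; lia.
rewrite big_split -!big_distrr /=.
by move: (\sum_(i < _) _) (\sum_(i < _) _) => v w; lia.
Qed.

End CentralBinomials.

(** * Signed sums over refinements as iterated differences *)

Section Refinements.
Variable K : fieldType.

Lemma compsAuxS f n : compsAux f.+1 n.+1 =
  flatten [seq [seq i :: c | c <- compsAux f (n.+1 - i)] | i <- iota 1 n.+1].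
Proof. by []. Qed.

Lemma compsAux_fuel f n : (n <= f)%N -> compsAux f n = comps n.
Proof.
have [k le_nk] := ubnP n; elim: k n f le_nk => // k IH [|n] [|f] // le_nk le_nf.
rewrite /comps !compsAuxS; congr flatten; apply/eq_in_map => i.
by rewrite mem_iota => hi; rewrite !IH //; lia.
Qed.

Lemma mem_compsAux f n b : b \in compsAux f n -> is_comp b.
Proof.
elim: f n b => [|f IH] [|n] b; rewrite ?compsAuxS; try by rewrite inE => /eqP->.
  by [].
case/flattenP => l /mapP[i]; rewrite mem_iota => hi -> /mapP[c /IH cc ->] /=.
by apply/andP; split; first lia.
Qed.

Lemma mem_refinements a b : b \in refinements a -> is_comp b.
Proof.
elim: a b => [|x a IH] b /=; first by rewrite inE => /eqP->.
case/flattenP => l /mapP[c /mem_compsAux cc ->] /mapP[d /IH cd ->].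
by rewrite /is_comp all_cat; apply/andP.
Qed.

Lemma sum_comps (F : seq nat -> K) n :
  \sum_(b <- comps n.+1) F b
    = \sum_(i < n.+1) \sum_(c <- comps (n - i)) F (i.+1 :: c).
Proof.
rewrite {1}/comps compsAuxS big_flatten big_map.
rewrite (iotaDl 1 0) big_map -{1}[n.+1]subn0 -/(index_iota 0 n.+1).
rewrite big_mkord; apply: eq_bigr => i _.
by rewrite big_map add1n subSS compsAux_fuel ?leq_subr.
Qed.

Lemma sum_refinements_cons (F : seq nat -> K) x a :
  \sum_(b <- refinements (x :: a)) F b
    = \sum_(c <- comps x) \sum_(d <- refinements a) F (c ++ d).
Proof.
rewrite /= big_flatten big_map /=.
by apply: eq_bigr => c _; rewrite big_map.
Qed.

(** Lowering a first part of at least 3 by 2 keeps length and parities, so these terms cancel those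
    with first part 2. Only first part 1 survives. *)
Lemma sum_comps_SS (phi : nat -> K) n :
  \sum_(b <- comps n.+3) (-1) ^+ size b * phi (count odd b)
    = - \sum_(b <- comps n.+2) (-1) ^+ size b * phi (count odd b).+1.
Proof.
rewrite [LHS]sum_comps big_ord_recl big_ord_recl /= addrA -[RHS]addr0 -addrA.
congr (_ + _).
  by rewrite subn0 -sumrN; apply: eq_bigr => b _; rewrite /= exprS mulN1r mulNr.
rewrite [X in X + _](_ : _ =
    - \sum_(b <- comps n.+1) (-1) ^+ size b * phi (count odd b)); last first.
  by rewrite -sumrN; apply: eq_bigr => b _; rewrite /= exprS mulN1r mulNr.
rewrite sum_comps addrC; apply/eqP; rewrite subr_eq0; apply/eqP.
by apply: eq_bigr => i _; apply: eq_bigr => c _; rewrite /= negbK.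
Qed.

(** Reading [phi j] as t^j, each further unit of [n] multiplies by -t, starting from t^2 - 1 at n =
    2. *)
Lemma sum_comps_sign (phi : nat -> K) n : (0 < n)%N ->
  \sum_(b <- comps n) (-1) ^+ size b * phi (count odd b)
    = (-1) ^+ n * (if (1 < n)%N then phi n - phi (n - 2)%N else phi n).
Proof.
case: n => // -[|n] _.
  by rewrite sum_comps big_ord_recl big_ord0 addr0 /comps /= big_seq1.
elim: n phi => [|n IH] phi.
  rewrite sum_comps !big_ord_recl big_ord0 /comps /= !big_seq1 /=; ring.
by rewrite sum_comps_SS (IH (fun j => phi j.+1)) /= !subSS !subn0 -mulNr [in RHS]exprS mulN1r.
Qed.

(** The polynomial is now (-t)^n: first part 1 leaves a sum without head condition, 2 gives nothing,
    and a larger one is lowered by 2. *)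
Lemma sum_comps_odd_head (phi : nat -> K) n : (0 < n)%N ->
  \sum_(b <- comps n)
     (if odd (head 1%N b) then (-1) ^+ size b * phi (count odd b) else 0)
    = (-1) ^+ n * phi n.
Proof.
have step m : \sum_(b <- comps m.+3)
     (if odd (head 1%N b) then (-1) ^+ size b * phi (count odd b) else 0)
   = - (\sum_(b <- comps m.+2) (-1) ^+ size b * phi (count odd b).+1)
     + \sum_(b <- comps m.+1)
     (if odd (head 1%N b) then (-1) ^+ size b * phi (count odd b) else 0).
  rewrite sum_comps big_ord_recl big_ord_recl /= [X in _ + (X + _)]big1 // add0r.
  congr (_ + _).
    by rewrite subn0 -sumrN; apply: eq_bigr => b _; rewrite /= exprS mulN1r mulNr.
  rewrite sum_comps; apply: eq_bigr => i _; apply: eq_bigr => c _.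
  by rewrite /= negbK.
have [k le_nk] := ubnP n; elim: k n le_nk => // k IH [//|[|[|n]]] le_nk _.
- by rewrite sum_comps big_ord_recl big_ord0 addr0 /comps /= big_seq1.
- rewrite sum_comps !big_ord_recl big_ord0 /comps /= !big_seq1 /=; ring.
rewrite step IH; [|lia|by []].
rewrite (sum_comps_sign (fun j => phi j.+1)) //= ?subSS ?subn0. rewrite !exprS; ring.
Qed.

(** Dual to multiplication by t^2 - 1; the step 2 preserves parity. *)
Definition fdiff (phi : nat -> K) (j : nat) : K := phi j.+2 - phi j.

Lemma fdiffE phi j : fdiff phi j = phi j.+2 - phi j.
Proof. by []. Qed.

Lemma iter_fdiff_shift p phi t j :
  iter p fdiff (fun i => phi (t + i)%N) j = iter p fdiff phi (t + j)%N.
Proof. by elim: p j => //= p IH j; rewrite {1}/fdiff !IH !addnS. Qed.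

Lemma sum_refinements_sign (phi : nat -> K) a : is_comp a ->
  \sum_(b <- refinements a) (-1) ^+ size b * phi (count odd b)
    = (-1) ^+ sumn a
        * iter (count (ltn 1) a) fdiff phi (sumn a - (count (ltn 1) a).*2)%N.
Proof.
elim: a phi => [|x a IH] phi; first by rewrite /= big_seq1.
case/andP=> x0 ca; rewrite sum_refinements_cons.
(* The sum over the tail sees [phi] shifted by the number of odd parts of [c], and differences
   commute with shifts. *)
under eq_bigr => c _.
  under eq_bigr => d _ do rewrite size_cat count_cat exprD -mulrA.
  rewrite -big_distrr /= (IH (fun j => phi (_ + j)%N) ca) iter_fdiff_shift.
  over.
rewrite (sum_comps_sign (fun j => _ * iter _ _ _ (j + _)%N)) //=.
have := count_gt1_double ca; rewrite exprD -mulrA; case: ltnP => hx hle.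
  rewrite -mulrBr add1n iterS fdiffE.
  set p := count _ _ in hle *.
  have -> : (x + sumn a - p.+1.*2).+2 = (x + (sumn a - p.*2))%N by lia.
  by have -> : (x + sumn a - p.+1.*2 = x - 2 + (sumn a - p.*2))%N by lia.
by rewrite add0n addnBA.
Qed.

(** The head condition concerns only the refinement of [x], which contributes (-t)^x and hence no
    difference; so the first entry is left out of the count. *)
Lemma sum_refinements_odd_head (phi : nat -> K) x a : is_comp (x :: a) ->
  \sum_(b <- refinements (x :: a))
     (if odd (head 1%N b) then (-1) ^+ size b * phi (count odd b) else 0)
    = (-1) ^+ (x + sumn a)
        * iter (count (ltn 1) a) fdiff phi (x + sumn a - (count (ltn 1) a).*2)%N.
Proof.
case/andP=> x0 ca; rewrite sum_refinements_cons.
rewrite (eq_big_seq (fun c => if odd (head 1%N c) then (-1) ^+ size c *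
  ((-1) ^+ sumn a * iter (count (ltn 1) a) fdiff phi
    (count odd c + (sumn a - (count (ltn 1) a).*2))%N) else 0)); last first.
  (* As [x] is positive, [c] is nonempty and supplies the head of [c ++ d]. *)
  move=> [|y c] hc /=.
    suff : [::] \notin comps x by rewrite hc.
    case: x x0 {hc} => // x _; rewrite /comps compsAuxS.
    by apply/flattenP => -[l /mapP[i _ ->] /mapP[]].
  case: (odd y); last by rewrite big1.
  rewrite -(iter_fdiff_shift _ phi) -sum_refinements_sign // big_distrr /=.
  by apply: eq_bigr => d _; rewrite size_cat count_cat -addSn exprD mulrA addnA.
rewrite (sum_comps_odd_head (fun j => _ * iter _ _ _ (j + _)%N)) //.
have := count_gt1_double ca; rewrite exprD -mulrA => hle.
by rewrite addnBA.
Qed.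

End Refinements.

(** * Closed forms of the even and odd parts *)

Section EvenOddParts.
Variable K : fieldType.
Hypothesis char_ne2 : (2%:R : K) != 0.

(* The coefficients of sqrt ((1 + T) / (1 - T)) = (1 + T) / sqrt (1 - T ^ 2). *)
Definition sqrt_coef (j : nat) : K := (Cpq 0 j./2)%:R / 4%:R ^+ j./2.

Lemma char_ne4 : (4%:R : K) != 0.
Proof. by rewrite -[4%N]/(2 * 2)%N natrM mulf_neq0. Qed.

(** One difference replaces C(p, q) by (C(p, q+1) - 4 C(p, q)) / 4 = -C(p+1, q) / 4. *)
Lemma iter_fdiff_sqrt_coef p j :
  iter p (@fdiff K) sqrt_coef j
    = (-1) ^+ p * (Cpq p j./2)%:R / 4%:R ^+ (p + j./2).
Proof.
elim: p j => [|p IH] j; first by rewrite mul1r.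
rewrite iterS {1}/fdiff !IH /=; move: (j./2) => q.
have /(congr1 (fun n => n%:R : K)) := Cpq_rec p q; rewrite natrD natrM => e.
have -> : (Cpq p.+1 q)%:R = 4%:R * (Cpq p q)%:R - (Cpq p q.+1)%:R :> K.
  by rewrite -e addrK.
rewrite addnS addSn !exprS; field.
by rewrite expf_neq0 ?char_ne4.
Qed.

Lemma sqrt_coef_conv m :
  \sum_(i < m.+1) sqrt_coef i.*2 * sqrt_coef (m - i).*2 = 1.
Proof.
have n4 := expf_neq0 m char_ne4.
apply: (mulIf n4); rewrite mul1r -[RHS]natrX -Cpq0_conv natr_sum big_distrl /=.
apply: eq_bigr => i _; rewrite /sqrt_coef !doubleK natrM.
have -> : 4%:R ^+ m = 4%:R ^+ i * 4%:R ^+ (m - i) :> K.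
  by rewrite -exprD subnKC // -ltnS.
field; rewrite !expf_neq0 ?char_ne4 //.
Qed.

(** With f the square root of (1 + T) / (1 - T), this is f(T) f(-T) = 1. Pairs of even indices sum
    to 1 and pairs of odd ones to -1, as coefficients 2i and 2i+1 agree. *)
Lemma sqrt_coef_alternating j : (0 < j)%N -> ~~ odd j ->
  \sum_(s < j.+1) (-1) ^+ (j - s) * (sqrt_coef s * sqrt_coef (j - s)) = 0.
Proof.
move=> j0 ev; have ej : j = (j./2).*2 by rewrite -[LHS]odd_double_half (negbTE ev).
case: (j./2) ej j0 => [|m] -> // _.
have split_parity (F : nat -> K) k : \sum_(s < k.*2.+1) F s
    = \sum_(i < k.+1) F i.*2 + \sum_(i < k) F i.*2.+1.
  elim: k => [|k IH]; first by rewrite !big_ord1 big_ord0 addr0.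
  rewrite doubleS 2!big_ord_recr /= IH [\sum_(i < k.+2) _]big_ord_recr /=.
  rewrite [\sum_(i < k.+1) F i.*2.+1]big_ord_recr /=; ring.
rewrite (split_parity (fun s => (-1) ^+ (m.+1.*2 - s)
  * (sqrt_coef s * sqrt_coef (m.+1.*2 - s)))).
transitivity (1 - 1 : K); last exact: subrr.
rewrite -[X in _ = X - _](sqrt_coef_conv m.+1).
rewrite -[X in _ = _ - X](sqrt_coef_conv m) -sumrN.
congr (_ + _); apply: eq_bigr => i _.
  by rewrite -doubleB -mul2n exprM sqrrN !expr1n mul1r.
have -> : (m.+1.*2 - i.*2.+1 = (m - i).*2.+1)%N by have := ltn_ord i; lia.
rewrite exprS -mul2n exprM sqrrN !expr1n mulr1 mulN1r mul2n.
by rewrite /sqrt_coef /= !uphalf_double !doubleK.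
Qed.

Definition even_part (a : seq nat) : K :=
  if odd (sumn a) then 0 else (-1) ^+ size a * sqrt_coef (count odd a).

(** The default head 1 makes the empty composition count as starting with an odd entry, so its value
    is 1. *)
Definition odd_part (a : seq nat) : K :=
  if odd (head 1%N a) then (-1) ^+ size a * sqrt_coef (count odd a) else 0.

Lemma sqrt_coef0 : sqrt_coef 0 = 1.
Proof. by rewrite /sqrt_coef divr1. Qed.

(** By [conv_zeta_cons], this is the relation zeta zp = bar zm for the closed forms. *)
Lemma even_odd_part_cons x a :
  even_part (x :: a) + even_part a = bar odd_part (x :: a).
Proof.
rewrite /even_part /odd_part /bar -[(-1) ^+ sumn _]signr_odd /= oddD odd_sumn exprS mulN1r /sqrt_coef.
case: (odd x); case: (boolP (odd (count odd a))) => oa /=;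
  rewrite ?add0n ?add1n ?uphalfE /= ?expr0 ?expr1 ?mul1r ?mulN1r ?mulNr ?opprK;
  rewrite ?uphalf_half ?oa ?(negbTE oa) ?add0n ?add1n ?addr0 ?add0r ?addNr ?oppr0 //.
Qed.

(** Nonzero terms need a right piece that is empty or starts with an odd entry; indexed by the odd
    entries to their left, they form the alternating sum above. *)
Lemma odd_part_conv x a : ~~ odd (sumn (x :: a)) ->
  conv odd_part (bar odd_part) (x :: a) = 0.
Proof.
move=> ev; have [ox|ex] := boolP (odd x); last first.
  rewrite conv_cons /bar {2}/odd_part /= (negbTE ex) !mulr0 add0r.
  by apply: big1 => i _; rewrite /odd_part /= (negbTE ex) mul0r.
set j := count odd (x :: a).
have j0 : (0 < j)%N by rewrite /j /= ox.
rewrite odd_sumn in ev.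
transitivity ((-1) ^+ size (x :: a) * \sum_(s < j.+1)
    (-1) ^+ (j - s) * (sqrt_coef s * sqrt_coef (j - s))); last first.
  by rewrite sqrt_coef_alternating ?mulr0.
rewrite -(sum_cuts_odd (fun s => (-1) ^+ (j - s) * (sqrt_coef s * sqrt_coef (j - s)))).
rewrite big_distrr; apply: eq_bigr => i _ /=.
have -> : odd_part (take i (x :: a))
    = (-1) ^+ size (take i (x :: a)) * sqrt_coef (count odd (take i (x :: a))).
  by rewrite /odd_part; case: (nat_of_ord i) => //= k; rewrite ox.
rewrite /bar -(signr_odd _ (sumn _)) odd_sumn signr_odd /odd_part.
case: ifP => _; last by rewrite !mulr0.
have -> : (j - count odd (take i (x :: a)))%N = count odd (drop i (x :: a)).
  by rewrite /j -{1}(cat_take_drop i (x :: a)) count_cat addKn.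
have -> : (-1) ^+ (size a).+1 = (-1) ^+ size (take i (x :: a))
     * (-1) ^+ size (drop i (x :: a)) :> K.
  by rewrite -exprD -size_cat cat_take_drop.
ring.
Qed.

(** Induction on length. In odd degree [zp] vanishes and the linear relation gives [zm]. In even
    degree the quadratic relation gives 2 [zm] in terms of shorter compositions, and then the linear
    one gives [zp]. *)
Lemma even_odd_parts_unique (zp zm : seq nat -> K) :
    zp [::] = 1 -> zm [::] = 1 -> is_even zp ->
    (forall a, is_comp a -> conv zm (bar zm) a = eps K a) ->
    (forall a, is_comp a -> conv (zeta K) zp a = bar zm a) ->
  forall a, is_comp a -> zp a = even_part a /\ zm a = odd_part a.
Proof.
move=> zp0 zm0 zp_even zm_sq zp_zm a.
have [k] := ubnP (size a); elim: k a => // k IH [|x a] le_ak ca.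
  by rewrite zp0 zm0 /even_part /odd_part /= sqrt_coef0 mul1r.
have ca' : is_comp a by case/andP: ca.
have [zpa _] := IH a le_ak ca'.
have rec := zp_zm _ ca; rewrite conv_zeta_cons zpa in rec.
have rec' := even_odd_part_cons x a.
have [od|ev] := boolP (odd (sumn (x :: a))).
  have zpE : zp (x :: a) = even_part (x :: a).
    by rewrite (even_odd_sum0 char_ne2 zp_even) // /even_part od.
  split=> //; apply: (mulfI (negbT (signr_eq0 K (sumn (x :: a))))).
  by move: rec rec'; rewrite zpE => -> .
suff zmE : zm (x :: a) = odd_part (x :: a).
  by split=> //; apply: (addIr (even_part a)); rewrite rec rec' /bar zmE.
have : conv zm (bar zm) (x :: a) = conv odd_part (bar odd_part) (x :: a).
  by rewrite zm_sq // odd_part_conv.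
rewrite !conv_ends.
have -> : \sum_(i < size a) zm (x :: take i a) * bar zm (drop i a)
  = \sum_(i < size a) odd_part (x :: take i a) * bar odd_part (drop i a).
  apply: eq_bigr => i _; have le_ia := ltn_ord i.
  have cx : is_comp (x :: take i a).
    by case/andP: ca => x0 _; apply/andP; split=> //; apply: is_comp_take.
  rewrite (IH (x :: take i a) _ cx).2; last first.
    by rewrite /= size_takel ?(ltnW le_ia) //; move: le_ak => /=; lia.
  rewrite /bar (IH (drop i a) _ (is_comp_drop i ca')).2 //.
  by rewrite size_drop; move: le_ak => /=; lia.
move/addIr; rewrite /bar zm0 /= -!(signr_odd _ (x + sumn a)) (negbTE ev).
rewrite /odd_part /= sqrt_coef0 !mul1r !mulr1 => e.
by apply: (mulfI char_ne2); rewrite !mulr_natl !mulr2n.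
Qed.

Lemma valF_odd_part x a : is_comp (x :: a) ->
  let p := count (ltn 1) a in let n := (x + sumn a)%N in
  valF odd_part (x :: a)
    = (-1) ^+ (n + p) * (Cpq p (n./2 - p))%:R / 4%:R ^+ n./2.
Proof.
move=> ca p n; rewrite /valF (sum_refinements_odd_head sqrt_coef ca) -/p -/n.
have hp : (p.*2 <= n)%N by case/andP: ca => x0 /count_gt1_double h; apply: leq_trans h (leq_addl _ _).
rewrite iter_fdiff_sqrt_coef (_ : (n - p.*2)./2 = n./2 - p)%N ?subnKC; [|lia|lia].
by rewrite exprD !mulrA.
Qed.

Lemma iter_fdiff_even p (phi : nat -> K) j :
  iter p (@fdiff K) (fun i => if odd i then 0 else phi i) j
    = if odd j then 0 else iter p (@fdiff K) phi j.
Proof.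
elim: p j => //= p IH j; rewrite !fdiffE !IH /= negbK.
by case: (odd j); rewrite ?subrr.
Qed.

Lemma valF_even_part a : is_comp a ->
  let p := count (ltn 1) a in let n := sumn a in
  valF even_part a = if odd n then 0
    else (-1) ^+ p * (Cpq p (n./2 - p))%:R / 4%:R ^+ n./2.
Proof.
move=> ca p n; have hp : (p.*2 <= n)%N by apply: count_gt1_double.
(* The parity of the degree is that of the number of odd entries, so the value depends only on that
   number and the length. *)
rewrite /valF (eq_bigr (fun b => (-1) ^+ size b *
    (if odd (count odd b) then 0 else sqrt_coef (count odd b)))); last first.
  by move=> b _; rewrite /even_part odd_sumn; case: ifP; rewrite ?mulr0.
rewrite (sum_refinements_sign (fun j => if odd j then 0 else sqrt_coef j)) //.
rewrite iter_fdiff_even -/p -/n oddB // odd_double addbF.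
case: ifP => on; first by rewrite mulr0.
rewrite -signr_odd on mul1r iter_fdiff_sqrt_coef.
by rewrite (_ : (n - p.*2)./2 = n./2 - p)%N ?subnKC; [|lia|lia].
Qed.

End EvenOddParts.

(** * Large parts and descents of the conjugate *)

Section Conjugate.
Local Open Scope nat_scope.

Local Notation gaps := (pairmap (fun x y => y - x)).

Definition run_start (q : pred nat) (e : nat) : bool := q e && ~~ q e.-1.

(** A gap exceeds 1 exactly where a run of [q] starts. Here [x] acts as the last point kept before
    [m]. *)
Lemma count_gaps (q : pred nat) x m l : x < m -> q m.-1 = (x == m.-1) ->
  count (ltn 1) (gaps x (filter q (iota m l))) = count (run_start q) (iota m l).
Proof.
elim: l x m => //= l IH x m lt_xm qm; rewrite /run_start qm.
case: (boolP (q m)) => [qm1|/negbTE qm1] /=; last first.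
  by rewrite add0n; apply: IH; [lia | rewrite /= qm1; lia].
rewrite (IH m m.+1) // ?qm1 ?eqxx //; congr (nat_of_bool _ + _); lia.
Qed.

(** With [m.-1] outside [q], the first point kept always starts a run, whence the successor. *)
Lemma count_gaps_behead (q : pred nat) m l : 0 < m -> ~~ q m.-1 ->
  count (run_start q) (iota m l)
    = if filter q (iota m l) is y :: s then (count (ltn 1) (gaps y s)).+1 else 0.
Proof.
elim: l m => //= l IH m m0 /negbTE qm; rewrite /run_start qm andbT.
case: (boolP (q m)) => [qm1|qm1] /=; last by rewrite -IH.
by rewrite (@count_gaps q m m.+1) // qm1 eqxx.
Qed.

Lemma pplus_comp_of_desc n s : pplus (comp_of_desc n s) =
  if s is y :: s' then (count (ltn 1) (gaps y s')).+1 else 0.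
Proof.
case: s => [|y s] //; rewrite /pplus /comp_of_desc /= pairmap_cat size_cat /=.
by rewrite addn1 /= take_size_cat.
Qed.

Lemma mem_scanl_addn t a e : is_comp a ->
  e \in scanl addn t a -> t < e <= t + sumn a.
Proof.
elim: a t => //= x a IH t /andP[x0 ca]; rewrite inE => /orP[/eqP->|/IH]; first lia.
by move=> /(_ ca); lia.
Qed.

Lemma scanl_addn_filter a : is_comp a ->
  scanl addn 0 a = filter (mem (scanl addn 0 a)) (iota 1 (sumn a)).
Proof.
move=> ca; apply: (irr_sorted_eq ltn_trans ltnn).
- suff h t : path ltn t (scanl addn t a) by apply: path_sorted (h 0).
  by elim: a t ca => //= x a IH t /andP[x0 /IH ->]; rewrite andbT; lia.
- exact/sorted_filter/iota_ltn_sorted/ltn_trans.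
move=> e; rewrite mem_filter mem_iota /=.
case: (boolP (e \in _)) => //= /(mem_scanl_addn ca); lia.
Qed.

Lemma scanl_descents a : a != [::] ->
  scanl addn 0 a = rcons (descents a) (sumn a).
Proof.
rewrite /descents; case/lastP: a => // a x _.
suff h t : scanl addn t (rcons a x) = rcons (scanl addn t a) (t + sumn (rcons a x)).
  by rewrite size_rcons h -cats1 take_size_cat ?size_scanl // cats1.
by elim: a t => /= [|y a IH] t; rewrite ?addn0 // IH addnA.
Qed.

Lemma count_iota_rev (q : pred nat) n :
  count q (iota 1 n) = count (fun e => q (n.+1 - e)) (iota 1 n).
Proof.
rewrite -!sum1_count -{1 2}[n](subn1 n.+1) -/(index_iota 1 n.+1) big_nat_rev.
by apply: eq_bigl => e; rewrite add1n subSS.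
Qed.

(* Conjugation reverses and complements descents, so the parts larger than 1,
   which are the runs of non-descents, become runs of descents. *)
Lemma pplus_conjc a : is_comp a -> pplus (conjc a) = count (ltn 1) a.
Proof.
move=> ca; have [->//|a0] := eqVneq a [::].
set n := sumn a; set D := scanl addn 0 a.
have DE : D = rcons (descents a) n by rewrite /D scanl_descents.
have n0 : 0 < n by case: (a) a0 ca @n @D {DE} => //= x b _ /andP[]; lia.
(* Adding 0 to the partial sums lets the first gap be measured from 0. *)
pose q e := (e == 0) || (e \in D).
have aE : gaps 0 D = a by apply: scanlK => x y; rewrite addnC addnK.
rewrite -{2}aE /D scanl_addn_filter // -/D -/n.
rewrite (@eq_in_filter _ _ q); last by move=> e; rewrite mem_iota /q /= => /andP[/lt0n_neq0/negbTE->].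
rewrite count_gaps // /conjc -/n -[n == 0]negbK -lt0n n0 /=.
rewrite pplus_comp_of_desc.
pose q' e := (0 < e) && ((n - e) \notin descents a).
rewrite (@eq_in_filter _ _ q'); last first.
  by move=> e; rewrite mem_iota /q' => /andP[->].
rewrite -count_gaps_behead // count_iota_rev prednK //.
rewrite -[in RHS](prednK n0) /= (_ : run_start q 1 = false) ?add0n; last by rewrite /run_start /= andbF.
rewrite (iotaDl 1 1) count_map; apply: eq_in_count => d.
rewrite mem_iota => hd; rewrite /run_start /q' /q /= add1n /=.
have qD e : 0 < e < n -> (e \in D) = (e \in descents a).
  by move=> he; rewrite DE mem_rcons inE; case: eqP => // e'; lia.
rewrite subKn; last lia.
have -> : 0 < n - d by lia.
have -> : (d == 0) = false by lia.
rewrite /= -(qD d) ?negb_and ?negbK; last lia.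
rewrite andbC; congr (_ && _).
(* The endpoint [n], a partial sum but not a descent, corresponds under reflection to 0, which [q']
   excludes. *)
have [e1|ne1] := eqVneq d.+1 n.
  by rewrite e1 DE mem_rcons inE eqxx; have -> : (n - d).-1 = 0 by lia.
have -> : n - (n - d).-1 = d.+1 by lia.
by rewrite qD; [have -> : 0 < (n - d).-1 by lia | lia].
Qed.

End Conjugate.

(** * Values on the fundamental basis *)

Theorem theorem8p7 (K : fieldType) (char_ne2 : (2%:R : K) != 0)
    (zp zm : seq nat -> K) :
  is_character zp -> is_even zp ->
  is_character zm -> is_odd zm ->
  is_conv_inverse (conv zp zm) (zeta K) ->
  forall alpha : seq nat, is_comp alpha ->
    let n := sumn alpha in
    valF zm alpha =
      (-1) ^+ (n + pminus (rev alpha)) / 2%:R ^+ (2 * n./2)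
        * (Cpq (pminus (rev alpha)) (n./2 - pminus (rev alpha)))%:R
    /\
    valF zp alpha =
      (if ~~ odd n then
         (-1) ^+ (pplus (conjc alpha)) / 2%:R ^+ n
           * (Cpq (pplus (conjc alpha)) (n./2 - pplus (conjc alpha)))%:R
       else 0).
Proof.
move=> [zp0 _] zp_even [zm0 _] zm_odd zinv a ca n.
have parts := even_odd_parts_unique char_ne2 zp0 zm0 zp_even
  (fun b cb => (zm_odd b cb).2) (conv_zeta_even_part zm_odd zinv).
have -> : valF zm a = valF (odd_part K) a.
  by apply: eq_big_seq => b /mem_refinements /parts[].
have -> : valF zp a = valF (even_part K) a.
  by apply: eq_big_seq => b /mem_refinements /parts[].
have pow4 k : 2%:R ^+ (2 * k) = 4%:R ^+ k :> K by rewrite exprM -natrX.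
split; last first.
  rewrite valF_even_part // pplus_conjc // -/n; case: (boolP (odd n)) => //= ev.
  have -> : 2%:R ^+ n = 4%:R ^+ n./2 :> K.
    by rewrite -pow4 mul2n -[in LHS](odd_double_half n) (negbTE ev).
  by rewrite mulrAC.
rewrite pow4 mulrAC {}/n; case: a ca => [|x a] ca.
  by rewrite /valF /= big_seq1 /odd_part /= sqrt_coef0 !mul1r expr0 invr1.
(* The last entry of the reversal, which [pminus] drops, is [x]. *)
rewrite valF_odd_part //; suff -> : pminus (rev (x :: a)) = count (ltn 1) a by [].
rewrite /pminus rev_cons size_rcons -cats1 take_size_cat // count_rev.
by apply: eq_count.
Qed.
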